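(* For any degree sequence $d=(d_1,\dots,d_n)$, both the intersection envelope graph $I(d)$ and the union envelope graph $U(d)$ are threshold graphs.
   Context: All graphs are finite and simple. Realizations of $d$ are labeled graphs on vertex set $[n]$ in which vertex $\ell$ has degree $d_\ell$. $I(d)$ is the graph on $[n]$ whose edge set is the intersection of the edge sets of all realizations of $d$; $U(d)$ is the graph on $[n]$ whose edge set is the union of the edge sets of all realizations of $d$. A threshold graph is a graph that is the unique (labeled) realization of its degree sequence; equivalently, a graph with no alternating 4-cycle, i.e. no four vertices $a,b,c,e$ with $ab, ce$ edges and $ae, bc$ non-edges. *)

(* Defs.v *)
From mathcomp Require Import all_boot.

Set Implicit Arguments.
Unset Strict Implicit.
Unset Printing Implicit Defensive.

(* A graph on the vertex set 'I_n is given by its edge set, a set of unordered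
   pairs; labeled graphs coincide exactly when their edge sets are equal. *)
Definition simple_graph (n : nat) (E : {set {set 'I_n}}) : bool :=
  [forall e in E, #|e| == 2].

Definition degree (n : nat) (E : {set {set 'I_n}}) (v : 'I_n) : nat :=
  #|[set e in E | v \in e]|.

Definition degree_seq (n : nat) (E : {set {set 'I_n}}) : n.-tuple nat :=
  [tuple degree E v | v < n].

Definition realization (n : nat) (d : n.-tuple nat) (E : {set {set 'I_n}}) :
    bool :=
  simple_graph E && [forall v, degree E v == tnth d v].

Definition graphic (n : nat) (d : n.-tuple nat) : Prop :=
  exists E : {set {set 'I_n}}, realization d E.

(* Meaningful for graphic d only: an empty intersection is the set of all
   subsets of 'I_n, which is not a graph. *)
Definition intersection_envelope (n : nat) (d : n.-tuple nat) :
    {set {set 'I_n}} :=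
  \bigcap_(E : {set {set 'I_n}} | realization d E) E.

Definition union_envelope (n : nat) (d : n.-tuple nat) : {set {set 'I_n}} :=
  \bigcup_(E : {set {set 'I_n}} | realization d E) E.

Definition threshold (n : nat) (E : {set {set 'I_n}}) : Prop :=
  simple_graph E /\
  forall F : {set {set 'I_n}}, realization (degree_seq E) F -> F = E.

(* Main.v *)
Require Import Defs.
From mathcomp Require Import all_boot.

Set Implicit Arguments.
Unset Strict Implicit.
Unset Printing Implicit Defensive.

(** If d_j <= d_i and a realization contains jk but not ik,
    then i has a neighbour u that j lacks, and replacing {jk, iu} by {ik, ju}
    gives a realization that contains ik but not jk.  Hence in both envelopes
    every neighbour of j other than i is a neighbour of i.  A graph H whose
    neighbourhoods are nested along some weight d in this way is determined by
    its degrees: if F has the same degrees and F <> H, take a vertex v of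
    maximal weight among those at which F and H differ, an edge vw of F - H and
    an edge wx of H - F; then d_x <= d_v, so xw in H forces vw in H. *)

Definition neighbors (n : nat) (E : {set {set 'I_n}}) (v : 'I_n) : {set 'I_n} :=
  [set u | [set v; u] \in E].

(** The condition [i != k] keeps [[set i; k]] from collapsing to a singleton. *)
Definition weight_nested (n : nat) (w : 'I_n -> nat) (E : {set {set 'I_n}}) :
    Prop :=
  forall i j k, i != j -> i != k -> w j <= w i ->
    [set j; k] \in E -> [set i; k] \in E.

Lemma simple_graph_neq (n : nat) (E : {set {set 'I_n}}) (u v : 'I_n) :
  simple_graph E -> [set u; v] \in E -> u != v.
Proof.
move=> /forall_inP sE /sE; rewrite cards2.
by case: (u != v).
Qed.

Lemma simple_graph_edgeP (n : nat) (E : {set {set 'I_n}}) (e : {set 'I_n}) :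
  simple_graph E -> e \in E -> exists u v, e = [set u; v].
Proof.
by move=> /forall_inP sE /sE /cards2P[u [v [_ ->]]]; exists u, v.
Qed.

Lemma in_neighbors (n : nat) (E : {set {set 'I_n}}) (u v : 'I_n) :
  (u \in neighbors E v) = ([set v; u] \in E).
Proof. by rewrite inE. Qed.

Lemma neighbors_sym (n : nat) (E : {set {set 'I_n}}) (u v : 'I_n) :
  (u \in neighbors E v) = (v \in neighbors E u).
Proof. by rewrite !in_neighbors setUC. Qed.

Lemma degree_neighbors (n : nat) (E : {set {set 'I_n}}) (v : 'I_n) :
  simple_graph E -> degree E v = #|neighbors E v|.
Proof.
move=> sE; have inj : {in neighbors E v &, injective (fun u => [set v; u])}.
  move=> x y; rewrite !in_neighbors => /(simple_graph_neq sE) vx _ exy.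
  have: x \in [set v; y] by rewrite -exy set22.
  by rewrite !inE eq_sym (negPf vx) => /eqP.
rewrite -(card_in_imset inj); apply: eq_card => e; rewrite inE.
apply/andP/imsetP => [[eE ve] | [u]]; last first.
  by rewrite in_neighbors => uE ->; rewrite set21.
have [x [y exy]] := simple_graph_edgeP sE eE.
move: ve eE; rewrite exy !inE => /orP[] /eqP -> eE.
  by exists y; rewrite ?in_neighbors.
by exists x; rewrite ?in_neighbors setUC.
Qed.

Lemma simple_graph_neighbors_inj (n : nat) (E F : {set {set 'I_n}}) :
  simple_graph E -> simple_graph F ->
  (forall v, neighbors E v = neighbors F v) -> E = F.
Proof.
move=> sE sF eEF; apply/setP => e; apply/idP/idP => eI.
  have [u [v ee]] := simple_graph_edgeP sE eI.
  by move: eI; rewrite ee -!in_neighbors eEF.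
have [u [v ee]] := simple_graph_edgeP sF eI.
by move: eI; rewrite ee -!in_neighbors eEF.
Qed.

(** Otherwise the neighbours of i other than j lie among those of j other than i, and properly so
    because of k. A possible edge ij counts equally in both degrees, so j would have the larger
    degree. *)
Lemma exists_exclusive_neighbor (n : nat) (E : {set {set 'I_n}}) (i j k : 'I_n) :
  simple_graph E -> i != k -> degree E j <= degree E i ->
  [set j; k] \in E -> [set i; k] \notin E ->
  exists u, [/\ u != j, [set i; u] \in E & [set j; u] \notin E].
Proof.
move=> sE ik dji jk nik.
have [/subsetP sub|/subsetPn[u]] :=
    boolP (neighbors E i :\ j \subset neighbors E j :\ i); last first.
  rewrite !in_setD1 !in_neighbors => /andP[uj iu]; rewrite negb_and negbK => ju.
  exists u; split=> //; case/orP: ju => // /eqP ui.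
  by move: (simple_graph_neq sE iu); rewrite ui eqxx.
have: neighbors E i :\ j \proper neighbors E j :\ i.
  apply/properP; split; first exact/subsetP.
  exists k; rewrite !in_setD1 !in_neighbors ?jk ?(negPf nik) ?andbF //.
  by rewrite eq_sym ik.
move/proper_card; move: dji.
rewrite !degree_neighbors // (cardsD1 i (neighbors E j)).
by rewrite (cardsD1 j (neighbors E i)) neighbors_sym leq_add2l leqNgt => /negP.
Qed.

(** The 2-switch along the alternating 4-cycle i, k, j, u. *)
Definition switch (n : nat) (E : {set {set 'I_n}}) (i j k u : 'I_n) :
    {set {set 'I_n}} :=
  [set i; k] |: ([set j; u] |: (E :\ [set j; k] :\ [set i; u])).

Lemma degreeE (n : nat) (E : {set {set 'I_n}}) (v : 'I_n) :
  degree E v = \sum_(e in E) (v \in e).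
Proof.
rewrite /degree -sum1_card big_mkcond [RHS]big_mkcond /=.
by apply: eq_bigr => e _; rewrite !inE; case: (e \in E); case: (v \in e).
Qed.

Lemma eq_pair_sum (T : eqType) (v x y : T) :
  x != y -> (v == x) || (v == y) = (v == x) + (v == y) :> nat.
Proof. by case: (eqVneq v x) => [->|]; case: eqP. Qed.

Lemma pair_eqr (T : finType) (x y z : T) :
  ([set x; z] == [set y; z]) = (x == y).
Proof.
apply/eqP/eqP => [e|-> //].
have: x \in [set y; z] by rewrite -e set21.
rewrite !inE => /orP[/eqP // | /eqP xz].
have: y \in [set x; z] by rewrite e set21.
by rewrite !inE xz orbb => /eqP.
Qed.

Lemma switch_realization (n : nat) (d : n.-tuple nat) (E : {set {set 'I_n}})
    (i j k u : 'I_n) :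
  realization d E -> i != j -> i != k -> u != j ->
  [set j; k] \in E -> [set i; u] \in E ->
  [set i; k] \notin E -> [set j; u] \notin E ->
  realization d (switch E i j k u).
Proof.
move=> /andP[sE /forallP dE] ij ik uj jk iu nik nju.
have jk_neq := simple_graph_neq sE jk; have iu_neq := simple_graph_neq sE iu.
have ju_neq : j != u by rewrite eq_sym.
apply/andP; split.
  apply/forall_inP => e; rewrite !inE => /or3P[/eqP->|/eqP->|/and3P[_ _ eE]].
  - by rewrite cards2 ik.
  - by rewrite cards2 ju_neq.
  - by move/forall_inP: sE => ->.
apply/forallP => v; rewrite -(eqP (dE v)) !degreeE /switch.
(* These inequalities allow the switched pairs to be split off the degree sums one at a time. *)
have iujk : [set i; u] != [set j; k].
  apply: contraNneq nik => e.
  have: i \in [set j; k] by rewrite -e set21.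
  by rewrite !inE (negPf ij) (negPf ik).
have ikju : [set i; k] != [set j; u].
  apply: contraNneq nik => e.
  have: i \in [set j; u] by rewrite -e set21.
  by rewrite !inE (negPf ij) (negPf iu_neq).
rewrite big_setU1 ?inE ?(negPf nik) ?(negPf ikju) ?andbF //=.
rewrite big_setU1 ?inE ?(negPf nju) ?andbF //=.
rewrite [X in _ == X](big_setD1 [set j; k]) //=.
rewrite [X in _ == _ + X](big_setD1 [set i; u]) ?inE ?iujk //=.
(* The sum over the untouched edges cancels. The removed and the added pairs each cover i, j, k, u
   once, so the remaining indicators agree up to order. *)
rewrite !addnA eqn_add2r !eq_pair_sum //.
by rewrite addnACA [X in _ == X]addnACA [X in X + _ == _]addnC.
Qed.

Lemma exchange (n : nat) (d : n.-tuple nat) (E : {set {set 'I_n}})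
    (i j k : 'I_n) :
  realization d E -> i != j -> i != k -> tnth d j <= tnth d i ->
  [set j; k] \in E -> [set i; k] \notin E ->
  exists F, [/\ realization d F, [set i; k] \in F & [set j; k] \notin F].
Proof.
move=> rE ij ik dji jk nik; have /andP[sE /forallP dE] := rE.
have dji' : degree E j <= degree E i by rewrite (eqP (dE j)) (eqP (dE i)).
have [u [uj iu nju]] := exists_exclusive_neighbor sE ik dji' jk nik.
exists (switch E i j k u); split; first exact: switch_realization.
  by rewrite !inE eqxx.
(* The pair jk was removed; it remains to see that it is neither of the two added pairs. *)
have jk_ju : [set j; k] != [set j; u] by apply: contraNneq nju => <-.
by rewrite !inE pair_eqr eq_sym (negPf ij) (negPf jk_ju) eqxx andbF.
Qed.

(** A realization lacking ik would be exchanged for one lacking jk, which lies in all of them. *)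
Lemma weight_nested_intersection (n : nat) (d : n.-tuple nat) :
  weight_nested (tnth d) (intersection_envelope d).
Proof.
move=> i j k ij ik dji /bigcapP jk; apply/bigcapP => E rE.
apply/negPn/negP => nik.
have [F [rF _ /negP]] := exchange rE ij ik dji (jk E rE) nik.
by apply; apply: jk.
Qed.

Lemma weight_nested_union (n : nat) (d : n.-tuple nat) :
  weight_nested (tnth d) (union_envelope d).
Proof.
move=> i j k ij ik dji /bigcupP[E rE jk]; apply/bigcupP.
have [ikE|nik] := boolP ([set i; k] \in E); first by exists E.
by have [F [rF ikF _]] := exchange rE ij ik dji jk nik; exists F.
Qed.

Lemma weight_nested_threshold (n : nat) (w : 'I_n -> nat)
    (H : {set {set 'I_n}}) :
  simple_graph H -> weight_nested w H -> threshold H.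
Proof.
move=> sH nest; split=> // F /andP[sF /forallP dF].
have eqdeg v : #|neighbors F v| = #|neighbors H v|.
  by rewrite -!degree_neighbors // (eqP (dF v)) tnth_mktuple.
(* As the degrees agree, non-inclusion in one direction is equivalent to non-inclusion in the other,
   so this one-sided test detects every difference. *)
pose differ v := ~~ (neighbors F v \subset neighbors H v).
have [v0 dv0|same] := pickP differ; last first.
  apply: simple_graph_neighbors_inj => // v; apply/eqP.
  by rewrite eqEcard eqdeg leqnn andbT; apply/negPn; rewrite -/(differ v) same.
have differ_sym v : ~~ (neighbors H v \subset neighbors F v) -> differ v.
  apply: contra => sub; suff -> : neighbors F v = neighbors H v by [].
  by apply/eqP; rewrite eqEcard sub eqdeg leqnn.
have differ_symV v : differ v -> ~~ (neighbors H v \subset neighbors F v).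
  apply: contra => sub; suff -> : neighbors H v = neighbors F v by [].
  by apply/eqP; rewrite eqEcard sub eqdeg leqnn.
have [v dv vmax] := arg_maxnP w dv0.
have /subsetPn[y Fvy Hvy] := dv.
have dy : differ y.
  by apply/subsetPn; exists v; rewrite neighbors_sym.
have /subsetPn[x Hyx Fyx] := differ_symV y dy.
(* This brings x under the maximality of v, giving [w x <= w v]. *)
have dx : differ x.
  by apply/differ_sym/subsetPn; exists y; rewrite neighbors_sym.
have vx : v != x.
  by apply: contraNneq Hvy => vx; rewrite neighbors_sym vx.
rewrite in_neighbors in Fvy; rewrite neighbors_sym in_neighbors in Hyx.
have Hvy' := nest v x y vx (simple_graph_neq sF Fvy) (vmax x dx) Hyx.
by rewrite in_neighbors Hvy' in Hvy.
Qed.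

Theorem theorem3p2 (n : nat) (d : n.-tuple nat) (hd : graphic d) :
  threshold (intersection_envelope d) /\ threshold (union_envelope d).
Proof.
split; apply: (@weight_nested_threshold _ (tnth d)).
(* A realization exists, and the intersection inherits two-element edges from it. *)
- have [E rE] := hd; have /andP[/forall_inP sE _] := rE.
  by apply/forall_inP => e /bigcapP /(_ E rE) /sE.
- exact: weight_nested_intersection.
- by apply/forall_inP => e /bigcupP[E /andP[/forall_inP sE _] /sE].
- exact: weight_nested_union.
Qed.
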